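(* Let $\|\cdot\|$ be an algebra norm on $M_n$. Then $\|\cdot\|$ is a generalized induced norm on the set $\mathcal{A}=\{A\in M_n : A \text{ is invertible and } \|A\|=\|A^{-1}\|=1\}$; that is, there exist norms $\|\cdot\|_1$ and $\|\cdot\|_2$ on $\mathbb{C}^n$ such that $\|A\|=\max\{\|Ax\|_2 : x\in\mathbb{C}^n,\ \|x\|_1=1\}$ for all $A\in\mathcal{A}$.
   Context: $M_n$ denotes the complex algebra of all $n\times n$ matrices over $\mathbb{C}$. An algebra norm on $M_n$ is a norm $\|\cdot\|$ on $M_n$ such that $\|AB\|\le\|A\|\,\|B\|$ for all $A,B\in M_n$ (it is not assumed that $\|I\|=1$). Given norms $\|\cdot\|_1,\|\cdot\|_2$ on $\mathbb{C}^n$, the norm $\|A\|_{1,2}=\max\{\|Ax\|_2:\|x\|_1=1\}$ on $M_n$ is called the generalized induced (g-ind) norm via $\|\cdot\|_1$ and $\|\cdot\|_2$. A norm on $M_n$ is said to be g-ind on a subset $\mathcal{A}\subseteq M_n$ if its restriction to $\mathcal{A}$ coincides with the restriction to $\mathcal{A}$ of some g-ind norm. *)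

(* Defs.v *)
From mathcomp Require Import all_boot all_order all_algebra.
From mathcomp Require Import complex.
From mathcomp Require Import classical_sets reals.

Set Implicit Arguments.
Unset Strict Implicit.
Unset Printing Implicit Defensive.

Import Order.TTheory GRing.Theory Num.Theory.

Local Open Scope classical_set_scope.
Local Open Scope ring_scope.

(* Norms are predicates on functions rather than [normedZmodType] instances,
   because several norms live on the same space. Their values are in R, hence
   the real-valued complex modulus [normc] (the generic modulus of a complex
   number is itself an element of R[i]). *)
Definition is_norm (R : realType) (V : lmodType R[i]) (N : V -> R) : Prop :=
  [/\ forall x, 0 <= N x,
      forall x, N x = 0 -> x = 0,
      forall (a : R[i]) x, N (a *: x) = Normc.normc a * N x &
      forall x y, N (x + y) <= N x + N y].

(* The identity matrix is not required to have norm 1. *)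
Definition is_algebra_norm (R : realType) (n : nat)
    (N : 'M[R[i]]_n -> R) : Prop :=
  is_norm N /\ forall A B, N (A *m B) <= N A * N B.

Definition is_max (R : realType) (S : set R) (m : R) : Prop :=
  S m /\ ubound S m.

(* The set whose maximum is the generalized induced norm of A via N1, N2. *)
Definition gind_values (R : realType) (n : nat) (N1 N2 : 'cV[R[i]]_n -> R)
    (A : 'M[R[i]]_n) : set R :=
  [set N2 (A *m x) | x in [set x | N1 x = 1]].

Definition gind_on (R : realType) (n : nat) (N : 'M[R[i]]_n -> R)
    (S : set 'M[R[i]]_n) : Prop :=
  exists N1 N2 : 'cV[R[i]]_n -> R,
    [/\ is_norm N1, is_norm N2 &
        forall A, S A -> is_max (gind_values N1 N2 A) (N A)].

(* Main.v *)
Require Import Defs.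
From mathcomp Require Import all_boot all_order all_algebra.
From mathcomp Require Import complex.
From mathcomp Require Import classical_sets reals.

Import Order.TTheory GRing.Theory Num.Theory.

Local Open Scope classical_set_scope.
Local Open Scope ring_scope.

(** An algebra norm [N] restricts to a norm [colnorm N] on column vectors, by
    viewing [x] as the matrix all of whose columns are [x]. These matrices form
    a left ideal, on which [A] acts as it does on [x]; submultiplicativity
    therefore says that [A] has operator norm at most [N A] for [colnorm N]
    ([colnorm_mulmx]). If [A] and its inverse both have norm 1, the two bounds
    make [A] an isometry of [colnorm N] ([colnorm_isometry]). Taking [colnorm N]
    for both norms, the values whose maximum is sought are thus all equal to
    [1 = N A], and the maximum is attained as soon as the unit sphere is
    nonempty, which follows from [N A = 1] since it excludes dimension 0. *)

Definition colnorm (R : realType) (n : nat) (N : 'M[R[i]]_n -> R)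
    (x : 'cV[R[i]]_n) : R := N (x *m (const_mx 1 : 'rV_n)).

Arguments colnorm {R n} N x.

Lemma mul_col_const1 (R : realType) (n : nat) (x : 'cV[R[i]]_n) i j :
  (x *m (const_mx 1 : 'rV_n)) i j = x i 0.
Proof. by rewrite mxE big_ord1 mxE mulr1. Qed.

Lemma colnorm_is_norm (R : realType) (n : nat) (N : 'M[R[i]]_n -> R) :
  is_norm N -> is_norm (colnorm N).
Proof.
case=> N_ge0 N_eq0 NZ N_triangle; split; rewrite /colnorm.
- by move=> x; apply: N_ge0.
- move=> x /N_eq0 x0; apply/colP => i.
  by rewrite -(mul_col_const1 _ _ _ i i) x0 !mxE.
- by move=> a x; rewrite -scalemxAl NZ.
- by move=> x y; rewrite mulmxDl; apply: N_triangle.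
Qed.

Lemma colnorm_mulmx (R : realType) (n : nat) (N : 'M[R[i]]_n -> R) A x :
  is_algebra_norm N -> colnorm N (A *m x) <= N A * colnorm N x.
Proof. by case=> _ N_mul; rewrite /colnorm -mulmxA; apply: N_mul. Qed.

Lemma colnorm_isometry (R : realType) (n : nat) (N : 'M[R[i]]_n -> R) A x :
  is_algebra_norm N -> A \in unitmx -> N A = 1 -> N (invmx A) = 1 ->
  colnorm N (A *m x) = colnorm N x.
Proof.
move=> hN uA NA NAV; apply/eqP; rewrite eq_le; apply/andP; split.
  by have := colnorm_mulmx _ _ _ A x hN; rewrite NA mul1r.
by have := colnorm_mulmx _ _ _ (invmx A) (A *m x) hN; rewrite mulKmx // NAV mul1r.
Qed.

Lemma is_norm0 (R : realType) (V : lmodType R[i]) (N : V -> R) :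
  is_norm N -> N 0 = 0.
Proof. by case=> _ _ NZ _; rewrite -(scale0r 0) NZ Normc.normc0 mul0r. Qed.

Lemma exists_norm1 (R : realType) (V : lmodType R[i]) (N : V -> R) (x : V) :
  is_norm N -> x != 0 -> exists y, N y = 1.
Proof.
case=> N_ge0 N_eq0 NZ _ x_neq0; exists (((N x)^-1)%:C%C *: x).
have Nx_neq0 : N x != 0 by apply: contraNneq x_neq0 => /N_eq0 ->.
rewrite NZ /Normc.normc /= expr0n addr0 sqrtr_sqr ger0_norm ?invr_ge0 //.
by rewrite mulVf.
Qed.

Theorem proposition2p1 (R : realType) (n : nat) (N : 'M[R[i]]_n -> R)
    (hN : is_algebra_norm N) :
  gind_on N [set A : 'M[R[i]]_n |
    [/\ A \in unitmx, N A = 1 & N (invmx A) = 1]].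
Proof.
have [N_norm _] := hN; have cN_norm := colnorm_is_norm _ _ _ N_norm.
exists (colnorm N), (colnorm N); split=> // A [uA NA NAV]; rewrite NA.
split; last first.
  by move=> _ [x /= Nx1 <-]; rewrite colnorm_isometry // Nx1.
have [x Nx1] : exists x, colnorm N x = 1.
  (* A column of ones is nonzero: otherwise [n = 0], so [A = 0] and [N A = 0]. *)
  apply: (exists_norm1 _ _ _ (const_mx 1) cN_norm).
  apply/eqP => /colP ones0.
  have A0 : A = 0 by apply/matrixP => i j; have := ones0 i;
    rewrite !mxE => /eqP; rewrite oner_eq0.
  by move/eqP: NA; rewrite A0 is_norm0 // eq_sym oner_eq0.
by exists x => //=; rewrite colnorm_isometry.
Qed.
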